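(* Let $\Omega\subset\mathbb{R}^d$, let $\mathbf{X}=\{\mathbf{x}_1,\ldots,\mathbf{x}_n\}\subset\Omega$ be distinct points, $\Psi_{\boldsymbol\theta}$ a positive definite function on $\Omega\times\Omega$, $\mathbf{h}=(h_1,\ldots,h_p)':\Omega\to\mathbb{R}^p$ regression functions, $f:\Omega\to\mathbb{R}$, $\mathbf{x}\in\Omega$, and let $\boldsymbol\vartheta=(\boldsymbol\beta'\;\;\boldsymbol\theta')'$ be an arbitrary parameter vector. Let $\delta>0$ and suppose $\kappa(\Psi_{\boldsymbol\theta}(\mathbf{X},\mathbf{X}))=r/\delta$ with $r<1$. Suppose the floating point approximations (denoted by tildes) satisfy $$\|\mathbf{h}(\mathbf{x})-\tilde{\mathbf{h}}(\mathbf{x})\|_2\le\delta\|\mathbf{h}(\mathbf{x})\|_2,\quad \|f(\mathbf{X})-\tilde f(\mathbf{X})\|_2\le\delta\|f(\mathbf{X})\|_2,\quad \|h_j(\mathbf{X})-\tilde h_j(\mathbf{X})\|_2\le\delta\|h_j(\mathbf{X})\|_2\ (j=1,\ldots,p),$$ $$\|\Psi_{\boldsymbol\theta}(\mathbf{X},\mathbf{X})-\tilde\Psi_{\boldsymbol\theta}(\mathbf{X},\mathbf{X})\|_2\le\delta\|\Psi_{\boldsymbol\theta}(\mathbf{X},\mathbf{X})\|_2,\quad \|\Psi_{\boldsymbol\theta}(\mathbf{x},\mathbf{X})-\tilde\Psi_{\boldsymbol\theta}(\mathbf{x},\mathbf{X})\|_2\le\delta\|\Psi_{\boldsymbol\theta}(\mathbf{x},\mathbf{X})\|_2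 .$$ Then the nominal emulator $\hat f_{\boldsymbol\vartheta}$ and the numeric emulator $\tilde f_{\boldsymbol\vartheta}$ satisfy $$\big|\hat f_{\boldsymbol\vartheta}(\mathbf{x})-\tilde f_{\boldsymbol\vartheta}(\mathbf{x})\big|\le \delta\|\mathbf{h}(\mathbf{x})\|_2\|\boldsymbol\beta\|_2+\frac{2\delta}{1-r}\|\Psi_{\boldsymbol\theta}(\mathbf{x},\mathbf{X})\|_2\left(\|f(\mathbf{X})\|_2+\|\boldsymbol\beta\|_2\sqrt{\sum_{j=1}^p\|h_j(\mathbf{X})\|_2^2}\right)g(\mathbf{X},\Psi_{\boldsymbol\theta}),$$ where $$g(\mathbf{X},\Psi_{\boldsymbol\theta})=\frac{\kappa(\Psi_{\boldsymbol\theta}(\mathbf{X},\mathbf{X}))+1}{\lambda_{\min}(\Psi_{\boldsymbol\theta}(\mathbf{X},\mathbf{X}))}.$$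
   Context: A positive definite function is a symmetric real kernel whose Gram matrix at any finite set of distinct points is (strictly) positive definite. For finite point sets, $\Psi_{\boldsymbol\theta}(\mathbf{A},\mathbf{B})=\{\Psi_{\boldsymbol\theta}(\mathbf{a}_i,\mathbf{b}_j)\}$ (so $\Psi_{\boldsymbol\theta}(\mathbf{x},\mathbf{X})$ is a row vector), $f(\mathbf{X})=(f(\mathbf{x}_1),\ldots,f(\mathbf{x}_n))'$, $h_j(\mathbf{X})=(h_j(\mathbf{x}_1),\ldots,h_j(\mathbf{x}_n))'$, and $\mathbf{H}(\mathbf{X})$ is the $n\times p$ matrix with rows $\mathbf{h}(\mathbf{x}_i)'$, i.e. with columns $h_j(\mathbf{X})$. $\lambda_{\max},\lambda_{\min}$ are the maximal and minimal eigenvalues, $\kappa(\cdot)=\lambda_{\max}(\cdot)/\lambda_{\min}(\cdot)$, and $\|\cdot\|_2$ is the Euclidean norm for vectors and the spectral norm for matrices. Nominal emulator at parameter $\boldsymbol\vartheta=(\boldsymbol\beta'\;\boldsymbol\theta')'$ (exact arithmetic): $$\hat f_{\boldsymbol\vartheta}(\mathbf{x})=\mathbf{h}(\mathbf{x})'\boldsymbol\beta+\Psi_{\boldsymbol\theta}(\mathbf{x},\mathbf{X})\Psi_{\boldsymbol\theta}(\mathbf{X},\mathbf{X})^{-1}\big(f(\mathbf{X})-\mathbf{H}(\mathbf{X})\boldsymbol\beta\big).$$ Numeric emulator: tildes denote the stored (floating point) versions: a vector $\tilde{\mathbf{h}}(\mathbf{x})\in\mathbb{R}^p$, vectors $\tilde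 f(\mathbf{X}),\tilde h_j(\mathbf{X})\in\mathbb{R}^n$, a row vector $\tilde\Psi_{\boldsymbol\theta}(\mathbf{x},\mathbf{X})$, and an $n\times n$ matrix $\tilde\Psi_{\boldsymbol\theta}(\mathbf{X},\mathbf{X})$; $\tilde{\mathbf{H}}(\mathbf{X})$ has columns $\tilde h_j(\mathbf{X})$. The numeric emulator is $$\tilde f_{\boldsymbol\vartheta}(\mathbf{x})=\tilde{\mathbf{h}}(\mathbf{x})'\boldsymbol\beta+\tilde\Psi_{\boldsymbol\theta}(\mathbf{x},\mathbf{X})\tilde\Psi_{\boldsymbol\theta}(\mathbf{X},\mathbf{X})^{-1}\tilde f(\mathbf{X})-\tilde\Psi_{\boldsymbol\theta}(\mathbf{x},\mathbf{X})\tilde\Psi_{\boldsymbol\theta}(\mathbf{X},\mathbf{X})^{-1}\tilde{\mathbf{H}}(\mathbf{X})\boldsymbol\beta,$$ where $\tilde{\mathbf{A}}^{-1}\tilde{\mathbf{b}}$ denotes the solution of the linear system $\tilde{\mathbf{A}}\mathbf{y}=\tilde{\mathbf{b}}$. *)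

(* Defs.v *)
From HB Require Import structures.
From mathcomp Require Import all_boot all_order all_algebra.
From mathcomp Require Import boolp classical_sets reals.

Set Implicit Arguments.
Unset Strict Implicit.
Unset Printing Implicit Defensive.

Import Order.TTheory GRing.Theory Num.Theory.
Local Open Scope classical_set_scope.
Local Open Scope ring_scope.

Section LinearAlgebra.
Context {R : realType}.

Definition enorm n (v : 'cV[R]_n) : R := Num.sqrt (\sum_i v i 0 ^+ 2).

Definition spectral_norm m n (A : 'M[R]_(m, n)) : R :=
  sup [set enorm (A *m v) | v in [set v : 'cV[R]_n | enorm v <= 1]].

(* A matrix has finitely many eigenvalues and, if it is symmetric and nonempty,
   at least one, so that this supremum and this infimum are attained. *)
Definition lambda_max n (A : 'M[R]_n) : R := sup [set a | eigenvalue A a].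

Definition lambda_min n (A : 'M[R]_n) : R := inf [set a | eigenvalue A a].

Definition kappa n (A : 'M[R]_n) : R := lambda_max A / lambda_min A.

(* When A is a unit this is the only solution of A *m Y = B; otherwise invmx A
   is A. A relative spectral error delta with delta * kappa < 1 cannot make a
   positive definite matrix singular, so only the first case occurs below. *)
Definition linsolve n k (A : 'M[R]_n) (B : 'M[R]_(n, k)) : 'M[R]_(n, k) :=
  invmx A *m B.

Definition posdefmx n (A : 'M[R]_n) : Prop :=
  A^T = A /\ forall v : 'cV[R]_n, v != 0 -> 0 < (v^T *m A *m v) 0 0.

End LinearAlgebra.

Section Kernels.
Context {R : realType} {T : Type}.

Definition kernel_mx m n (K : T -> T -> R) (a : 'I_m -> T) (b : 'I_n -> T) :
  'M[R]_(m, n) := \matrix_(i, j) K (a i) (b j).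

Definition kernel_row n (K : T -> T -> R) (x : T) (X : 'I_n -> T) : 'rV[R]_n :=
  kernel_mx K (fun _ : 'I_1 => x) X.

Definition eval_col n (f : T -> R) (X : 'I_n -> T) : 'cV[R]_n :=
  \col_i f (X i).

Definition reg_vec p (h : 'I_p -> T -> R) (x : T) : 'cV[R]_p := \col_j h j x.

Definition reg_mx n p (h : 'I_p -> T -> R) (X : 'I_n -> T) : 'M[R]_(n, p) :=
  \matrix_(i, j) h j (X i).

Definition positive_definite_on (Omega : set T) (K : T -> T -> R) : Prop :=
  (forall a b, Omega a -> Omega b -> K a b = K b a) /\
  (forall m (Y : 'I_m -> T), injective Y -> (forall i, Omega (Y i)) ->
     posdefmx (kernel_mx K Y Y)).

End Kernels.

Section Emulators.
Context {R : realType}.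

Definition nominal_emulator (T : Type) n p q (Psi : 'cV[R]_q -> T -> T -> R)
    (h : 'I_p -> T -> R) (f : T -> R) (X : 'I_n -> T)
    (beta : 'cV[R]_p) (theta : 'cV[R]_q) (x : T) : R :=
  ((reg_vec h x)^T *m beta
   + kernel_row (Psi theta) x X *m invmx (kernel_mx (Psi theta) X X)
       *m (eval_col f X - reg_mx h X *m beta)) 0 0.

(* The arguments are the stored values of h(x), f(X), the h_j(X), Psi(x, X)
   and Psi(X, X). *)
Definition numeric_emulator n p (hx : 'cV[R]_p) (fX : 'cV[R]_n)
    (hX : 'I_p -> 'cV[R]_n) (PsixX : 'rV[R]_n) (PsiXX : 'M[R]_n)
    (beta : 'cV[R]_p) : R :=
  let HX : 'M[R]_(n, p) := \matrix_(i, j) hX j i 0 in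
  (hx^T *m beta + PsixX *m linsolve PsiXX fX
   - PsixX *m linsolve PsiXX HX *m beta) 0 0.

Definition gfactor n (A : 'M[R]_n) : R := (kappa A + 1) / lambda_min A.

End Emulators.

(* Main.v *)
(** Write A = Psi(X, X) with extreme eigenvalues m <= M, b = f(X) - H(X) beta,
and let A', b' and k' be the stored versions of A, b and the row k = Psi(x, X).
Since |A| <= M, the error A - A' has norm at most delta M = r m, so that
|A' v| >= (1 - r) m |v|; hence A' is invertible, and for A y = b, A' y' = b' the
identity A' (y - y') = (b - b') - (A - A') y bounds y - y'. The bound on the
emulators follows from k y - k' y' = k (y - y') + (k - k') y' and delta^2 <= r,
which holds because kappa >= 1. *)

Require Import Defs.
From mathcomp Require Import all_boot all_order all_algebra.
From mathcomp Require Import boolp classical_sets reals.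
From mathcomp Require Import ring lra.

Set Implicit Arguments.
Unset Strict Implicit.
Unset Printing Implicit Defensive.

Import Order.TTheory GRing.Theory Num.Theory.
Local Open Scope ring_scope.

(** * Bilinear forms, Euclidean and Frobenius norms *)

Section BilinearForm.
Context {R : realType}.

(** At [S = 1%:M] this is the Euclidean inner product; keeping [S] general lets one Cauchy-Schwarz
    inequality serve both it and semidefinite forms. *)
Definition bform n (S : 'M[R]_n) (u v : 'cV[R]_n) : R := (u^T *m S *m v) 0 0.

Definition psdmx n (S : 'M[R]_n) : Prop :=
  S^T = S /\ forall v, 0 <= bform S v v.

Lemma bformDl n (S : 'M[R]_n) u v w :
  bform S (u + v) w = bform S u w + bform S v w.
Proof. by rewrite /bform linearD /= !mulmxDl mxE. Qed.

Lemma bformDr n (S : 'M[R]_n) u v w :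
  bform S w (u + v) = bform S w u + bform S w v.
Proof. by rewrite /bform mulmxDr mxE. Qed.

Lemma bformZl n (S : 'M[R]_n) c u v : bform S (c *: u) v = c * bform S u v.
Proof. by rewrite /bform linearZ /= -!scalemxAl mxE. Qed.

Lemma bformZr n (S : 'M[R]_n) c u v : bform S u (c *: v) = c * bform S u v.
Proof. by rewrite /bform -!scalemxAr mxE. Qed.

Lemma bformC n (S : 'M[R]_n) u v : S^T = S -> bform S u v = bform S v u.
Proof.
move=> sS; transitivity ((u^T *m S *m v)^T 0 0); first by rewrite mxE.
by rewrite !trmx_mul trmxK sS mulmxA.
Qed.

Lemma bform_mulmx n (S : 'M[R]_n) u v : bform S u v = bform 1%:M u (S *m v).
Proof. by rewrite /bform mulmx1 mulmxA. Qed.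

Lemma bformB n (S T : 'M[R]_n) u v : bform (S - T) u v = bform S u v - bform T u v.
Proof. by rewrite /bform mulmxBr mulmxBl !mxE. Qed.

Lemma bformN n (S : 'M[R]_n) u v : bform (- S) u v = - bform S u v.
Proof. by rewrite /bform mulmxN mulNmx mxE. Qed.

Lemma bform_scalar n a (u v : 'cV[R]_n) : bform a%:M u v = a * bform 1%:M u v.
Proof. by rewrite /bform mulmx1 mul_mx_scalar -scalemxAl mxE. Qed.

Lemma enorm_ge0 n (v : 'cV[R]_n) : 0 <= enorm v.
Proof. exact: sqrtr_ge0. Qed.

Lemma sqr_enorm n (v : 'cV[R]_n) : enorm v ^+ 2 = \sum_i v i 0 ^+ 2.
Proof. by rewrite sqr_sqrtr // sumr_ge0 // => i _; rewrite sqr_ge0. Qed.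

Lemma bform1E n (v : 'cV[R]_n) : bform 1%:M v v = enorm v ^+ 2.
Proof.
by rewrite sqr_enorm /bform mulmx1 mxE; apply: eq_bigr => i _; rewrite mxE expr2.
Qed.

Lemma psdmx1 n : psdmx (1%:M : 'M[R]_n).
Proof. by split=> [|v]; rewrite ?trmx1 // bform1E sqr_ge0. Qed.

(** The form at [s *: u + t *: v] is a nonnegative quadratic in [s] and [t], to be evaluated at
    well-chosen values. *)
Lemma psdmx_cauchy_schwarz n (S : 'M[R]_n) u v : psdmx S ->
  bform S u v ^+ 2 <= bform S u u * bform S v v.
Proof.
case=> sS pS; set a := bform S u u; set b := bform S u v; set c := bform S v v.
have q (s t : R) : 0 <= s ^+ 2 * a + 2 * s * t * b + t ^+ 2 * c.
  have := pS (s *: u + t *: v).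
  rewrite !(bformDl, bformDr, bformZl, bformZr) (bformC v u) // -/a -/b -/c.
  by congr (0 <= _); ring.
have := pS v; rewrite -/c; clearbody a b c; rewrite le0r => /orP[/eqP c0|c0].
  (* With [c = 0] these values turn [q] into [0 <= - b ^+ 2]. *)
  by have := q b (- (a + 1) / 2); rewrite c0; nra.
(* Here [q] reads [0 <= c * (a * c - b ^+ 2)]. *)
rewrite -subr_ge0 -(pmulr_rge0 _ c0); have := q c (- b).
by congr (0 <= _); ring.
Qed.

Lemma enorm_eq0 n (v : 'cV[R]_n) : enorm v = 0 -> v = 0.
Proof.
move=> v0; apply/matrixP => i j; rewrite ord1 mxE; apply/eqP; rewrite -sqrf_eq0.
have /eqP := sqr_enorm v; rewrite v0 expr0n eq_sym /= psumr_eq0.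
  by move/allP/(_ i (mem_index_enum _)).
by move=> k _; rewrite sqr_ge0.
Qed.

Lemma enorm0 n : enorm (0 : 'cV[R]_n) = 0.
Proof. by apply/eqP; rewrite -sqrf_eq0 -bform1E /bform mulmx0 mxE. Qed.

Lemma enorm_gt0 n (v : 'cV[R]_n) : v != 0 -> 0 < enorm v.
Proof.
by move=> v0; rewrite lt0r enorm_ge0 andbT; apply: contra v0 => /eqP/enorm_eq0 ->.
Qed.

Lemma enormZ n c (v : 'cV[R]_n) : enorm (c *: v) = `|c| * enorm v.
Proof.
apply/eqP; rewrite -(@eqrXn2 _ 2) ?mulr_ge0 ?enorm_ge0 // exprMn -!bform1E.
by rewrite bformZl bformZr mulrA real_normK ?num_real.
Qed.

Lemma enormN n (v : 'cV[R]_n) : enorm (- v) = enorm v.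
Proof. by rewrite -scaleN1r enormZ normrN1 mul1r. Qed.

Lemma ler_bform n (u v : 'cV[R]_n) : `|bform 1%:M u v| <= enorm u * enorm v.
Proof.
rewrite -ler_sqr ?nnegrE ?mulr_ge0 ?enorm_ge0 //.
rewrite real_normK ?num_real // exprMn -!bform1E.
exact/psdmx_cauchy_schwarz/psdmx1.
Qed.

Lemma ler_enormD n (u v : 'cV[R]_n) : enorm (u + v) <= enorm u + enorm v.
Proof.
rewrite -ler_sqr ?nnegrE ?addr_ge0 ?enorm_ge0 // -bform1E.
rewrite !(bformDl, bformDr) !bform1E (bformC v u) ?trmx1 //.
have := ler_norm (bform 1%:M u v); have := ler_bform u v; nra.
Qed.

Lemma ler_enormB n (u v : 'cV[R]_n) : enorm (u - v) <= enorm u + enorm v.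
Proof. by rewrite -(enormN v) ler_enormD. Qed.

Lemma ler_norm_mulmx n (u : 'rV[R]_n) (v : 'cV[R]_n) :
  `|(u *m v) 0 0| <= enorm u^T * enorm v.
Proof. by have := ler_bform u^T v; rewrite /bform mulmx1 trmxK. Qed.

(** Grouped by columns, since the square root in the emulator bound is this norm of H(X). It also
    serves to show that the suprema and infima below are finite. *)
Definition frobenius m n (A : 'M[R]_(m, n)) : R :=
  Num.sqrt (\sum_j enorm (col j A) ^+ 2).

Lemma sqr_frobenius m n (A : 'M[R]_(m, n)) :
  frobenius A ^+ 2 = \sum_j enorm (col j A) ^+ 2.
Proof. by rewrite sqr_sqrtr // sumr_ge0 // => j _; rewrite sqr_ge0. Qed.

Lemma ler_enorm_frobenius m n (A : 'M[R]_(m, n)) v :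
  enorm (A *m v) <= enorm v * frobenius A.
Proof.
rewrite -ler_sqr ?nnegrE ?mulr_ge0 ?enorm_ge0 ?sqrtr_ge0 // exprMn.
rewrite sqr_frobenius.
(* Regrouping by rows allows Cauchy-Schwarz on each entry of [A *m v]. *)
have -> : \sum_j enorm (col j A) ^+ 2 = \sum_i enorm (row i A)^T ^+ 2.
  under eq_bigr do rewrite sqr_enorm.
  rewrite exchange_big; apply: eq_bigr => i _; rewrite sqr_enorm.
  by apply: eq_bigr => j _; rewrite !mxE.
rewrite sqr_enorm mulr_sumr; apply: ler_sum => i _.
have -> : (A *m v) i 0 = (row i A *m v) 0 0 by rewrite -row_mul [RHS]mxE.
rewrite -real_normK ?num_real // mulrC -exprMn.
by rewrite lerXn2r ?nnegrE ?mulr_ge0 ?enorm_ge0 ?ler_norm_mulmx.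
Qed.

End BilinearForm.

(** * The spectral norm as an operator norm *)

Section SpectralNorm.
Context {R : realType}.

(** The Frobenius norm bounds the set, so its supremum is a genuine upper bound; homogeneity carries
    it from the unit ball to every [v]. *)
Lemma spectral_norm_ge m n (A : 'M[R]_(m, n)) v :
  enorm (A *m v) <= spectral_norm A * enorm v.
Proof.
have [->|v0] := eqVneq v 0; first by rewrite mulmx0 !enorm0 mulr0.
have nv := enorm_gt0 v0; rewrite -ler_pdivrMr //.
apply: ub_le_sup.
  exists (frobenius A) => _ [w /= w1 <-].
  apply: le_trans (ler_enorm_frobenius _ _) _.
  by rewrite ler_piMl ?sqrtr_ge0.
exists ((enorm v)^-1 *: v) => /=.
  by rewrite enormZ ger0_norm ?invr_ge0 ?enorm_ge0 // mulVf ?gt_eqF.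
by rewrite -scalemxAr enormZ ger0_norm ?invr_ge0 ?enorm_ge0 // mulrC.
Qed.

Lemma spectral_norm_le m n (A : 'M[R]_(m, n)) c : 0 <= c ->
  (forall v, enorm (A *m v) <= c * enorm v) -> spectral_norm A <= c.
Proof.
move=> c0 Ac; apply: ge_sup.
  by exists (enorm (A *m 0)); exists 0 => //=; rewrite enorm0.
move=> _ [v /= v1 <-]; apply: le_trans (Ac v) _; exact: ler_piMr.
Qed.

End SpectralNorm.

(** * Extreme eigenvalues of symmetric matrices *)

Section RayleighQuotient.
Context {R : realType}.

(** Cauchy-Schwarz for [S] at [S *m v] and [v] reads |Sv|^4 <= S(Sv, Sv) S(v, v) <= c |Sv|^2 S(v,
    v); divide by |Sv|^2. *)
Lemma psdmx_sqr_enorm n (S : 'M[R]_n) c : psdmx S ->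
  (forall v, bform S v v <= c * enorm v ^+ 2) ->
  forall v, enorm (S *m v) ^+ 2 <= c * bform S v v.
Proof.
move=> pS Sc v; have [->|w0] := eqVneq (S *m v) 0.
  case: (pS) => _ pS0; rewrite enorm0 expr0n /=.
  have [->|v0] := eqVneq v 0; first by rewrite /bform mulmx0 mxE mulr0.
  (* A nonzero [v] forces [c] to be nonnegative. *)
  rewrite mulr_ge0 //; have := le_trans (pS0 v) (Sc v).
  by rewrite pmulr_lge0 // exprn_gt0 ?enorm_gt0.
have w20 : 0 < enorm (S *m v) ^+ 2 by rewrite exprn_gt0 ?enorm_gt0.
have := psdmx_cauchy_schwarz (S *m v) v pS; rewrite [X in X ^+ 2]bform_mulmx bform1E.
move=> /le_trans /(_ (ler_wpM2r (proj2 pS v) (Sc (S *m v)))).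
by rewrite [leLHS]expr2 [leRHS]mulrAC ler_pM2r.
Qed.

Lemma eigenvalue_unitmx n (A : 'M[R]_n) a :
  eigenvalue A a = (A - a%:M \notin unitmx).
Proof. by rewrite /eigenvalue /eigenspace kermx_eq0 row_free_unit. Qed.

(** Library eigenvectors are rows; symmetry makes their transposes column eigenvectors. *)
Lemma sym_eigenvector n (A : 'M[R]_n) a : A^T = A -> eigenvalue A a ->
  exists2 v : 'cV[R]_n, v != 0 & A *m v = a *: v.
Proof.
move=> sA /eigenvalueP[u uA u0]; exists u^T; first by rewrite trmx_eq0.
by rewrite -{1}sA -trmx_mul uA linearZ.
Qed.

(* The infimum [a] of the Rayleigh quotient is an eigenvalue: were the positive
   semidefinite matrix [S = A - a] invertible, its form would be bounded below
   by a positive multiple of the squared norm, and [a] could be increased. *)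
Lemma rayleigh_eigenvalue n (A : 'M[R]_n) : (0 < n)%N -> A^T = A ->
  exists2 a, eigenvalue A a & forall v, a * enorm v ^+ 2 <= bform A v v.
Proof.
move=> n0 sA.
pose E := [set bform A v v | v in [set v : 'cV[R]_n | enorm v = 1]]%classic.
have ubF v : `|bform A v v| <= frobenius A * enorm v ^+ 2.
  rewrite bform_mulmx; apply: le_trans (ler_bform _ _) _.
  rewrite expr2 mulrA [leLHS]mulrC ler_wpM2r ?enorm_ge0 // mulrC.
  exact: ler_enorm_frobenius.
have E0 : (E !=set0)%classic.
  pose w : 'cV[R]_n := delta_mx (Ordinal n0) 0.
  have w0 : 0 < enorm w.
    apply: enorm_gt0; apply/eqP => /matrixP/(_ (Ordinal n0) 0)/eqP.
    by rewrite !mxE !eqxx oner_eq0.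
  exists (bform A ((enorm w)^-1 *: w) ((enorm w)^-1 *: w)), ((enorm w)^-1 *: w) => //=.
  by rewrite enormZ ger0_norm ?invr_ge0 ?enorm_ge0 // mulVf ?gt_eqF.
have Elb : has_lbound E.
  exists (- frobenius A) => _ [v /= v1 <-].
  by have := ubF v; rewrite v1 expr1n mulr1 ler_norml => /andP[].
have infE v : inf E * enorm v ^+ 2 <= bform A v v.
  have [->|v0] := eqVneq v 0; first by rewrite enorm0 /bform mulmx0 mxE expr0n mulr0.
  have nv := enorm_gt0 v0.
  have /(ge_inf Elb) : E (bform A ((enorm v)^-1 *: v) ((enorm v)^-1 *: v)).
    exists ((enorm v)^-1 *: v) => //=.
    by rewrite enormZ ger0_norm ?invr_ge0 ?enorm_ge0 // mulVf ?gt_eqF.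
  rewrite bformZl bformZr mulrA -invfM mulrC -expr2 ler_pdivlMr //.
  by rewrite exprn_gt0.
exists (inf E) => //; rewrite eigenvalue_unitmx; apply/negP.
set S := A - _ => uS.
have SE v : bform S v v = bform A v v - inf E * enorm v ^+ 2.
  by rewrite bformB bform_scalar bform1E.
have pS : psdmx S.
  split=> [|v]; first by rewrite linearB /= sA tr_scalar_mx.
  by rewrite SE subr_ge0.
pose c := frobenius A + `|inf E|.
have Sc v : bform S v v <= c * enorm v ^+ 2.
  rewrite SE mulrDl; have := ubF v; have := sqr_ge0 (enorm v).
  have := ler_norm (- inf E); rewrite normrN ler_norml; nra.
(* From |v| <= |S^-1|_F |Sv| and |Sv|^2 <= c S(v, v), the form satisfies 1 <= D S(v, v) on unit
   vectors. *)
pose D := c * frobenius (invmx S) ^+ 2.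
have D0 : 0 <= D by rewrite mulr_ge0 ?sqr_ge0 // addr_ge0 ?sqrtr_ge0.
have DS v : enorm v = 1 -> 1 <= D * bform S v v.
  move=> v1; have := ler_enorm_frobenius (invmx S) (S *m v).
  rewrite mulKmx // v1 => /(exprn_ege1 2)/le_trans; apply.
  rewrite exprMn [leRHS]mulrAC; apply: ler_wpM2r; first exact: sqr_ge0.
  exact: psdmx_sqr_enorm.
(* A unit vector exists, and [DS] there excludes [D = 0]. *)
have {}D0 : 0 < D.
  case: E0 => _ [v /= v1 _]; rewrite lt0r D0 andbT; apply/eqP => D00.
  by have := DS v v1; rewrite D00 mul0r ler10.
suff : inf E + D^-1 <= inf E by rewrite gerDl leNgt invr_gt0 D0.
apply: lb_le_inf => // _ [v /= v1 <-]; have := DS v v1.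
by rewrite mulrC -ler_pdivrMr // div1r SE v1 expr1n mulr1 lerBrDl.
Qed.

(** An eigenvector for [b] turns the Rayleigh bound into [a <= b], so the eigenvalue [a] is the
    least one. *)
Lemma lambda_min_sym n (A : 'M[R]_n) : (0 < n)%N -> A^T = A ->
  eigenvalue A (lambda_min A) /\
  forall v, lambda_min A * enorm v ^+ 2 <= bform A v v.
Proof.
move=> n0 sA; have [a Aa ray] := rayleigh_eigenvalue n0 sA.
have lbE : lbound [set b | eigenvalue A b]%classic a.
  move=> b /= /(sym_eigenvector sA)[v v0 Av]; have := ray v.
  by rewrite bform_mulmx Av bformZr bform1E ler_pM2r // exprn_gt0 ?enorm_gt0.
suff -> : lambda_min A = a by [].
apply/eqP; rewrite eq_le; apply/andP; split; first by apply: ge_inf => //; exists a.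
by apply: lb_le_inf => //; exists a.
Qed.

Lemma eigenvalueN n (A : 'M[R]_n) a : eigenvalue (- A) a = eigenvalue A (- a).
Proof.
rewrite !eigenvalue_unitmx -opprD -scaleN1r unitmxZ ?unitrN1 //.
by rewrite [(- a)%:M]raddfN opprK.
Qed.

(** Negation reflects the spectrum, so the bound for the largest eigenvalue follows from that for
    the smallest. *)
Lemma lambda_maxE n (A : 'M[R]_n) : lambda_max A = - lambda_min (- A).
Proof.
rewrite /lambda_max /lambda_min /inf opprK; congr sup.
apply/seteqP; split=> [a /= Aa|_ /= [a Aa <-]].
  exists (- a); last exact: opprK.
  by rewrite /= eigenvalueN opprK.
by rewrite -eigenvalueN.
Qed.

Lemma lambda_max_sym n (A : 'M[R]_n) : (0 < n)%N -> A^T = A ->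
  forall v, bform A v v <= lambda_max A * enorm v ^+ 2.
Proof.
move=> n0 sA v; have sN : (- A)^T = - A by rewrite linearN /= sA.
by have [_ /(_ v)] := lambda_min_sym n0 sN; rewrite lambda_maxE bformN; lra.
Qed.

End RayleighQuotient.

(** * Spectral bounds for positive definite matrices *)

Section PosDefMatrix.
Context {R : realType} {n : nat} (n0 : (0 < n)%N) (A : 'M[R]_n) (pA : posdefmx A).

Lemma posdefmx_psdmx : psdmx A.
Proof.
case: pA => sA pv; split=> // v; have [->|v0] := eqVneq v 0.
  by rewrite /bform mulmx0 mxE.
exact/ltW/pv.
Qed.

Lemma lambda_min_gt0 : 0 < lambda_min A.
Proof.
case: pA => sA pv; have [/(sym_eigenvector sA)[v v0 Av] _] := lambda_min_sym n0 sA.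
have := pv v v0; rewrite -[X in 0 < X]/(bform A v v) bform_mulmx Av bformZr bform1E.
by rewrite pmulr_lgt0 // exprn_gt0 ?enorm_gt0.
Qed.

(** With m the least eigenvalue, m |v|^2 <= <v, Av> <= |v| |Av|; cancel |v|. *)
Lemma lambda_min_mulmx v : lambda_min A * enorm v <= enorm (A *m v).
Proof.
have [->|v0] := eqVneq v 0; first by rewrite mulmx0 enorm0 mulr0.
have [_ /(_ v)] := lambda_min_sym n0 pA.1.
rewrite bform_mulmx => /le_trans /(_ (ler_norm _)) /le_trans /(_ (ler_bform _ _)).
by rewrite expr2 mulrA mulrC ler_pM2l // enorm_gt0.
Qed.

(** The eigenvector supplies a nonzero vector at which the two Rayleigh bounds are compared. *)
Lemma lambda_min_le_max : lambda_min A <= lambda_max A.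
Proof.
have [/(sym_eigenvector pA.1)[v v0 _] /(_ v)] := lambda_min_sym n0 pA.1.
move=> /le_trans /(_ (lambda_max_sym n0 pA.1 v)).
by rewrite ler_pM2r // exprn_gt0 ?enorm_gt0.
Qed.

Lemma lambda_max_gt0 : 0 < lambda_max A.
Proof. exact: lt_le_trans lambda_min_gt0 lambda_min_le_max. Qed.

(** With M the largest eigenvalue, |Av|^2 <= M <v, Av> <= M^2 |v|^2. *)
Lemma spectral_norm_lambda_max : spectral_norm A <= lambda_max A.
Proof.
have M0 := ltW lambda_max_gt0; apply: spectral_norm_le => // v.
rewrite -ler_sqr ?nnegrE ?mulr_ge0 ?enorm_ge0 // exprMn.
have Amax := lambda_max_sym n0 pA.1.
apply: le_trans (psdmx_sqr_enorm posdefmx_psdmx Amax v) _.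
by rewrite [lambda_max A ^+ 2]expr2 -mulrA ler_wpM2l.
Qed.

End PosDefMatrix.

(** * Perturbation of a linear system *)

Section PerturbedSystem.
Context {R : realType}.

(** The lower bound makes the kernel trivial; [kermx] is a left kernel, hence the passage to
    [A^T]. *)
Lemma enorm_lbound_unitmx n (A : 'M[R]_n) c : 0 < c ->
  (forall v, c * enorm v <= enorm (A *m v)) -> A \in unitmx.
Proof.
move=> c0 Ac; rewrite -unitmx_tr -row_free_unit -kermx_eq0.
apply/eqP/row_matrixP => i; rewrite row0; apply/trmx_inj; rewrite trmx0.
apply: enorm_eq0; have := Ac (row i (kermx A^T))^T.
rewrite -[A in A *m _]trmxK -trmx_mul -row_mul mulmx_ker row0 trmx0 enorm0.
by rewrite pmulr_rle0 // => le0; apply/le_anti; rewrite le0 enorm_ge0.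
Qed.

(** [B] is kept apart from [enorm b] because the error of f(X) - H(X) beta is relative to |f(X)| and
    |H(X)|_F |beta|, whose size cancellation can hide in |b|. *)
Lemma linsolve_perturbation n (A At : 'M[R]_n) (b bt : 'cV[R]_n) (k kt : 'rV[R]_n)
    (delta r B : R) : (0 < n)%N -> posdefmx A ->
  0 < delta -> kappa A = r / delta -> r < 1 ->
  spectral_norm (A - At) <= delta * spectral_norm A ->
  enorm (k - kt)^T <= delta * enorm k^T ->
  enorm b <= B -> enorm (b - bt) <= delta * B ->
  `|(k *m linsolve A b - kt *m linsolve At bt) 0 0|
    <= 2 * delta / (1 - r) * enorm k^T * B * gfactor A.
Proof.
move=> n0 pA d0 kE r1 EA kk bB bbB.
have m0 := lambda_min_gt0 n0 pA; have Amin := lambda_min_mulmx n0 pA.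
have mM := lambda_min_le_max n0 pA; have sM := spectral_norm_lambda_max n0 pA.
rewrite /gfactor kE; set m := lambda_min A in m0 Amin mM *.
have MrE : delta * lambda_max A = r * m.
  rewrite -[lambda_max A](divfK (lt0r_neq0 m0)) -[_ / m]/(kappa A) kE.
  by field; rewrite gt_eqF.
have rd : delta <= r by rewrite -(ler_pM2r m0) -MrE ler_pM2l.
have E1 v : enorm ((A - At) *m v) <= r * m * enorm v.
  apply: le_trans (spectral_norm_ge _ _) _; rewrite ler_wpM2r ?enorm_ge0 //.
  by rewrite -MrE; apply: le_trans EA _; rewrite ler_pM2l.
(* Triangle inequality on [A *m v], split as [At *m v + (A - At) *m v]. *)
have Atmin v : (1 - r) * m * enorm v <= enorm (At *m v).
  have := ler_enormD (At *m v) ((A - At) *m v).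
  by rewrite -mulmxDl addrC subrK; have := Amin v; have := E1 v; lra.
have rm0 : 0 < (1 - r) * m by rewrite mulr_gt0 // subr_gt0.
have uAt := enorm_lbound_unitmx rm0 Atmin.
have uA := enorm_lbound_unitmx m0 Amin.
set y := linsolve A b; set yt := linsolve At bt.
have Ay : A *m y = b by rewrite mulKVmx.
have Atyt : At *m yt = bt by rewrite mulKVmx.
have B0 : 0 <= B by apply: le_trans bB; apply: enorm_ge0.
have yB : m * enorm y <= B by rewrite (le_trans (Amin y)) // Ay.
have ytB : (1 - r) * m * enorm yt <= (1 + delta) * B.
  apply: le_trans (Atmin yt) _; rewrite Atyt.
  by have := ler_enormB b (b - bt); rewrite subKr; lra.
have yytB : (1 - r) * m * enorm (y - yt) <= (delta + r) * B.
  apply: le_trans (Atmin _) _.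
  have -> : At *m (y - yt) = (b - bt) - (A - At) *m y.
    by rewrite mulmxBr mulmxBl Ay Atyt; apply/matrixP => i j; rewrite !mxE; ring.
  by have := ler_enormB (b - bt) ((A - At) *m y); have := E1 y; nra.
have -> : k *m y - kt *m yt = k *m (y - yt) + (k - kt) *m yt.
  by rewrite mulmxBr mulmxBl addrA subrK.
rewrite mxE; apply: le_trans (ler_normD _ _) _.
apply: le_trans (lerD (ler_norm_mulmx _ _) (ler_norm_mulmx _ _)) _.
(* The factor [delta] absorbs the condition number: [delta * (r / delta + 1) = r + delta]. *)
have -> : 2 * delta / (1 - r) * enorm k^T * B * ((r / delta + 1) / m) =
    2 * (delta + r) * B * enorm k^T / ((1 - r) * m).
  by field; rewrite !gt_eqF // subr_gt0.
rewrite ler_pdivlMr //; have k0 := enorm_ge0 k^T.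
have h1 : enorm k^T * ((1 - r) * m * enorm (y - yt)) <= enorm k^T * ((delta + r) * B).
  exact: ler_wpM2l.
have h2 : enorm (k - kt)^T * ((1 - r) * m * enorm yt)
    <= delta * enorm k^T * ((1 + delta) * B).
  by apply: ler_pM => //; rewrite ?enorm_ge0 // mulr_ge0 ?enorm_ge0 // ltW.
(* The bounds [h1] and [h2] add up to [2 * delta + r + delta ^+ 2] times |k| B, and
   [2 * (delta + r)] is allowed; the slack is [r - delta ^+ 2], nonnegative as [delta <= r < 1]. *)
have h3 : 0 <= enorm k^T * B * (r - delta * delta).
  by rewrite mulr_ge0 ?mulr_ge0 //; nra.
lra.
Qed.

End PerturbedSystem.

(** * Error bound for the emulators *)

Theorem proposition4p1 (R : realType) (d n p q : nat) (n_gt0 : (0 < n)%N)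
    (Omega : set 'cV[R]_d)
    (X : 'I_n -> 'cV[R]_d) (X_inj : injective X) (X_Omega : forall i, Omega (X i))
    (beta : 'cV[R]_p) (theta : 'cV[R]_q)
    (Psi : 'cV[R]_q -> 'cV[R]_d -> 'cV[R]_d -> R)
    (Psi_pd : positive_definite_on Omega (Psi theta))
    (h : 'I_p -> 'cV[R]_d -> R) (f : 'cV[R]_d -> R)
    (x : 'cV[R]_d) (x_Omega : Omega x)
    (delta r : R) (delta_gt0 : 0 < delta)
    (kappaE : kappa (kernel_mx (Psi theta) X X) = r / delta) (r_lt1 : r < 1)
    (hx_fl : 'cV[R]_p) (fX_fl : 'cV[R]_n) (hX_fl : 'I_p -> 'cV[R]_n)
    (PsiXX_fl : 'M[R]_n) (PsixX_fl : 'rV[R]_n)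
    (hx_err : enorm (reg_vec h x - hx_fl) <= delta * enorm (reg_vec h x))
    (fX_err : enorm (eval_col f X - fX_fl) <= delta * enorm (eval_col f X))
    (hX_err : forall j : 'I_p,
       enorm (eval_col (h j) X - hX_fl j) <= delta * enorm (eval_col (h j) X))
    (PsiXX_err :
       spectral_norm (kernel_mx (Psi theta) X X - PsiXX_fl)
         <= delta * spectral_norm (kernel_mx (Psi theta) X X))
    (PsixX_err :
       enorm (kernel_row (Psi theta) x X - PsixX_fl)^T
         <= delta * enorm (kernel_row (Psi theta) x X)^T) :
  `| nominal_emulator Psi h f X beta theta x
     - numeric_emulator hx_fl fX_fl hX_fl PsixX_fl PsiXX_fl beta |
  <= delta * enorm (reg_vec h x) * enorm beta
     + 2 * delta / (1 - r) * enorm (kernel_row (Psi theta) x X)^T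
       * (enorm (eval_col f X)
          + enorm beta * Num.sqrt (\sum_(j < p) enorm (eval_col (h j) X) ^+ 2))
       * gfactor (kernel_mx (Psi theta) X X).
Proof.
set A := kernel_mx _ X X in kappaE PsiXX_err *; set k := kernel_row _ x X in PsixX_err *.
have pA : posdefmx A by apply: Psi_pd.2.
pose HX := reg_mx h X; pose HXt : 'M[R]_(n, p) := \matrix_(i, j) hX_fl j i 0.
pose sH := Num.sqrt (\sum_(j < p) enorm (eval_col (h j) X) ^+ 2).
have colH j : col j HX = eval_col (h j) X by apply/matrixP => i l; rewrite !mxE.
have froH : frobenius HX = sH.
  by congr Num.sqrt; apply: eq_bigr => j _; rewrite colH.
(* The relative errors of the columns add up, in squares, to a relative Frobenius error. *)
have froHt : frobenius (HX - HXt) <= delta * sH.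
  rewrite -ler_sqr ?nnegrE ?mulr_ge0 ?sqrtr_ge0 ?(ltW delta_gt0) // exprMn.
  rewrite -froH !sqr_frobenius mulr_sumr; apply: ler_sum => j _.
  have -> : col j (HX - HXt) = eval_col (h j) X - hX_fl j.
    by apply/matrixP => i l; rewrite !mxE ord1.
  by rewrite colH -exprMn lerXn2r ?nnegrE ?mulr_ge0 ?enorm_ge0 // ltW.
set B := enorm (eval_col f X) + enorm beta * sH.
pose b := eval_col f X - HX *m beta; pose bt := fX_fl - HXt *m beta.
have b0 := enorm_ge0 beta.
have bB : enorm b <= B.
  by rewrite (le_trans (ler_enormB _ _)) // lerD2l -froH ler_enorm_frobenius.
have bbB : enorm (b - bt) <= delta * B.
  have -> : b - bt = (eval_col f X - fX_fl) - (HX - HXt) *m beta.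
    by rewrite mulmxBl; apply/matrixP => i j; rewrite !mxE; ring.
  apply: le_trans (ler_enormB _ _) _; rewrite mulrDr lerD //.
  apply: le_trans (ler_enorm_frobenius _ _) _.
  by rewrite mulrCA ler_wpM2l.
have solve := linsolve_perturbation n_gt0 pA delta_gt0 kappaE r_lt1 PsiXX_err
  PsixX_err bB bbB.
(* By linearity the two solves of the numeric emulator merge into one with right-hand side [bt],
   leaving the regression error plus a difference of solves. *)
have -> : nominal_emulator Psi h f X beta theta x
    - numeric_emulator hx_fl fX_fl hX_fl PsixX_fl PsiXX_fl beta =
    ((reg_vec h x - hx_fl)^T *m beta) 0 0
    + (k *m linsolve A b - PsixX_fl *m linsolve PsiXX_fl bt) 0 0.
  rewrite /nominal_emulator /numeric_emulator /linsolve -/HXt -/A -/k.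
  rewrite -/HX -/b !mulmxA.
  have -> (M N : 'M[R]_1) : M 0 0 - N 0 0 = (M - N) 0 0 by rewrite !mxE.
  have <- (M N : 'M[R]_1) : (M + N) 0 0 = M 0 0 + N 0 0 by rewrite mxE.
  congr (fun_of_matrix _ 0 0).
  rewrite [(_ - _)^T]linearB mulmxBl [_ *m bt]mulmxBr !mulmxA.
  by rewrite -[_ + _ - _ *m HXt *m beta]addrA opprD addrACA.
apply: le_trans (ler_normD _ _) (lerD _ solve).
apply: le_trans (ler_norm_mulmx _ _) _; rewrite trmxK.
exact: ler_wpM2r.
Qed.
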